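(* Let $W\subset\mathbb{R}^n$ be a simply-connected open set with coordinates $x^1,\dots,x^n$, and let $S=(S_{ij})$ be a smooth $n\times n$ matrix of real-valued functions on $W$, nondegenerate at every point of $W$, such that for every $i$ the entries $S_{i1},\dots,S_{in}$ of the $i$-th row are functions of $x^i$ only. Let $H_1,\dots,H_n$ be the Hamiltonians of the Stäckel system constructed from $S$, with corresponding symmetric $(2,0)$-tensors $H_{(\alpha)}^{ij}$, and put $\phi:=\det(S)$. Then the second order differential operators $$\hat H_\alpha=\sum_{i,j=1}^n\frac{1}{\phi}\,\frac{\partial}{\partial x^i}\,H_{(\alpha)}^{ij}\,\phi\,\frac{\partial}{\partial x^j},\qquad \alpha=1,\dots,n,$$ acting on smooth functions on $W$, commute: $\hat H_\alpha\hat H_\beta=\hat H_\beta\hat H_\alpha$ for all $\alpha,\beta\in\{1,\dots,n\}$.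
   Context: Let $p_1,\dots,p_n$ be the momenta corresponding to $x^1,\dots,x^n$ on $T^*W$. The Stäckel construction associates to $S$ the functions $H_1,\dots,H_n:T^*W\to\mathbb{R}$ (the Hamiltonians) determined by the linear system $$S\,(H_1,\dots,H_n)^\top=(p_1^2,\dots,p_n^2)^\top .$$ They are quadratic in the momenta, and $H_{(\alpha)}^{ij}$ denotes the symmetric tensor with $H_\alpha=\sum_{i,j}H_{(\alpha)}^{ij}p_ip_j$. In the coordinates $x^i$ it is diagonal, with $H_{(\alpha)}^{ii}=(S^{-1})_{\alpha i}$ and $H_{(\alpha)}^{ij}=0$ for $i\neq j$. In the formula for $\hat H_\alpha$, the expression is a composition of operators: $\hat H_\alpha f=\sum_{i,j}\frac1\phi\frac{\partial}{\partial x^i}\left(H_{(\alpha)}^{ij}\,\phi\,\frac{\partial f}{\partial x^j}\right)$. *)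

(* Defs.v *)
From HB Require Import structures.
From mathcomp Require Import all_boot all_order all_algebra.
From mathcomp Require Import all_classical all_reals all_analysis.

Set Implicit Arguments.
Unset Strict Implicit.
Unset Printing Implicit Defensive.

Import Order.TTheory GRing.Theory Num.Theory.
Import numFieldNormedType.Exports.

Local Open Scope classical_set_scope.
Local Open Scope ring_scope.

Section SimplyConnected.
Context {R : realType} {T : topologicalType}.

Definition path_in (W : set T) (g : R -> T) (x y : T) : Prop :=
  [/\ {within `[0, 1]%classic, continuous g},
      (forall t, t \in `[0, 1] -> W (g t)), g 0 = x & g 1 = y].

(* [h (s, t)]: [s] is the deformation parameter, [t] the parameter of the
   loop; the endpoints stay at [x] during the deformation. *)
Definition null_homotopic_in (W : set T) (g : R -> T) (x : T) : Prop :=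
  exists h : R * R -> T,
    [/\ {within `[0, 1]%classic `*` `[0, 1]%classic, continuous h},
        (forall s t, s \in `[0, 1] -> t \in `[0, 1] -> W (h (s, t))),
        (forall t, t \in `[0, 1] -> h (0, t) = g t /\ h (1, t) = x) &
        (forall s, s \in `[0, 1] -> h (s, 0) = x /\ h (s, 1) = x)].

Definition simply_connected (W : set T) : Prop :=
  (forall x y, W x -> W y -> exists g, path_in W g x y) /\
  (forall g x, path_in W g x x -> null_homotopic_in W g x).

End SimplyConnected.
Arguments simply_connected R {T} W.

Section Smooth.
Context {R : realType} {n : nat}.
Implicit Types (W : set 'rV[R]_n) (f : 'rV[R]_n -> R).

Definition partial (i : 'I_n) f (x : 'rV[R]_n) : R :=
  'D_(delta_mx 0 i) f x.

(* Functions on an open set [W] are represented by total functions whose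
   values outside [W] are irrelevant: all conditions, and the values of
   [partial] at points of [W], depend only on the restriction to [W]. *)
Fixpoint Cn_on (k : nat) W f : Prop :=
  (forall x, W x -> {for x, continuous f}) /\
  (if k is k'.+1 then
     forall i, (forall x, W x -> derivable f x (delta_mx 0 i)) /\
               Cn_on k' W (partial i f)
   else True).

Definition smooth_on W f : Prop := forall k, Cn_on k W f.

End Smooth.

Section Stackel.
Context {R : realType} {n : nat}.
Implicit Types (W : set 'rV[R]_n) (S : 'rV[R]_n -> 'M[R]_n).

Definition row_separated W S : Prop :=
  forall i j x y, W x -> W y -> x 0 i = y 0 i -> S x i j = S y i j.

(* [H a x p] is the value of the [a]-th Hamiltonian at the point of [T*W] with
   position [x] and momenta [p]. *)
Definition stackel_hamiltonians W S
    (H : 'I_n -> 'rV[R]_n -> 'rV[R]_n -> R) : Prop :=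
  forall x p, W x ->
    S x *m (\col_a H a x p) = \col_i (p 0 i ^+ 2).

Definition symmetric_tensor_of W (h : 'rV[R]_n -> 'rV[R]_n -> R)
    (K : 'rV[R]_n -> 'M[R]_n) : Prop :=
  forall x, W x ->
    (K x)^T = K x /\
    forall p, h x p = \sum_i \sum_j K x i j * p 0 i * p 0 j.

Definition divergence_op (phi : 'rV[R]_n -> R) (K : 'rV[R]_n -> 'M[R]_n)
    (f : 'rV[R]_n -> R) (x : 'rV[R]_n) : R :=
  \sum_i \sum_j
    (phi x)^-1 * partial i (fun y => K y i j * phi y * partial j f y) x.

End Stackel.

(* Main.v *)
Require Import Defs.
From HB Require Import structures.
From mathcomp Require Import all_boot all_order all_algebra.
From mathcomp Require Import all_classical all_reals all_analysis.
From mathcomp Require Import ring lra.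

Set Implicit Arguments.
Unset Strict Implicit.
Unset Printing Implicit Defensive.

Import Order.TTheory GRing.Theory Num.Theory.
Import numFieldNormedType.Exports.

Local Open Scope classical_set_scope.
Local Open Scope ring_scope.

(** The key is to avoid differentiating the inverse matrix.  Since the tensor
    of [H a] is diagonal with entries the [a]-th row of [S^-1], the product of
    its [i]-th entry with [phi = \det S] is a cofactor of [S] along the [i]-th
    row; that cofactor only involves the other rows, so it does not depend on
    [x_i] and comes out of [partial i].  Hence [Hhat a] is the operator
    [L a = \sum_i (S^-1)_ai (partial i)^2] ([divergence_op_stackel]), and
    conversely [\sum_b S_ib (L b f) = (partial i)^2 f] for every [i]
    ([stackel_opE]).

    Apply [(partial j)^2] with [j != i] to the last identity.  The entries
    [S_ib] do not depend on [x_j], so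
      [\sum_b S_ib (partial j)^2 (L b f) = (partial j)^2 (partial i)^2 f].
    Fix a point and put [M_ab = L a (L b f)], [S] being the matrix at that
    point.  As [\sum_a S_ja (L a g) = (partial j)^2 g] for all [g], the left
    side is the [(j, i)] entry of [S *m M *m S^T].  The right side is symmetric
    in [i] and [j] because partial derivatives commute, so [S *m M *m S^T] is
    symmetric off the diagonal, hence symmetric; as [S] is invertible, [M] is
    symmetric ([stackel_opC]), which is the commutation of [L a] and [L b].

    Two pieces of analysis support this.  Equality of mixed directional
    derivatives ([derive_commute]) compares two evaluations of a second
    difference by the mean value theorem.  The stability of [Cn_on] under
    sums, products, inverses and determinants gives the derivatives of [L b f]
    that the argument differentiates. *)

(** * Equality of mixed directional derivatives *)

Lemma is_derive_line (R : realType) (V : normedModType R) (f : V -> R)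
    (x v : V) (s : R) :
  derivable f (x + s *: v) v ->
  is_derive s 1 (fun t => f (x + t *: v)) ('D_v f (x + s *: v)).
Proof.
move=> df; have E :
    (fun h : R => h^-1 *: (((fun t => f (x + t *: v)) \o shift s) (h *: 1)
      - f (x + s *: v))) =
    (fun h : R => h^-1 *: ((f \o shift (x + s *: v)) (h *: v) - f (x + s *: v))).
  apply/funext => h /=; congr (_ *: (f _ - _)).
  by rewrite scalerDl [h *: 1]mulr1 addrCA.
by split; rewrite /derivable /derive E.
Qed.

Lemma is_derive_translate (R : realType) (V : normedModType R) (f : V -> R)
    (x u v : V) :
  derivable f (x + u) v ->
  is_derive x v (fun z => f (z + u)) ('D_v f (x + u)).
Proof.
move=> df; have E : (fun h : R => h^-1 *: (((fun z => f (z + u)) \o shift x) (h *: v)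
      - f (x + u))) =
    (fun h : R => h^-1 *: ((f \o shift (x + u)) (h *: v) - f (x + u))).
  by apply/funext => h /=; rewrite addrA.
by split; rewrite /derivable /derive E.
Qed.

Lemma MVT_line (R : realType) (V : normedModType R) (f : V -> R)
    (x v : V) (h : R) :
  0 < h -> (forall s, 0 <= s <= h -> derivable f (x + s *: v) v) ->
  exists2 c, 0 <= c <= h &
    f (x + h *: v) - f x = h * 'D_v f (x + c *: v).
Proof.
move=> h0 df; have D s : 0 <= s <= h ->
    is_derive s 1 (fun t => f (x + t *: v)) ('D_v f (x + s *: v)).
  by move=> sh; apply: is_derive_line; exact: df.
have [||c] := @MVT R (fun t => f (x + t *: v)) (fun s => 'D_v f (x + s *: v)) 0 h h0.
- by move=> s; rewrite in_itv /= => /andP[s0 sh]; apply: D; rewrite !ltW.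
- apply: derivable_within_continuous => s; rewrite in_itv /= => sh.
  by have [] := D s sh.
- rewrite in_itv /= => /andP[c0 ch]; rewrite scale0r addr0 subr0 => ->.
  by exists c; [rewrite !ltW|rewrite mulrC].
Qed.

(** Two mean value theorems: along [v] for the increment
    [z |-> f (z + h *: w) - f z], then along [w] for ['D_v f].  The second
    difference itself is symmetric in [v] and [w], which is how it gives the
    equality of mixed derivatives. *)
Lemma second_difference (R : realType) (V : normedModType R) (f : V -> R)
    (x v w : V) (h : R) :
  0 < h ->
  (forall s t, 0 <= s <= h -> 0 <= t <= h ->
     derivable f (x + s *: v + t *: w) v /\
     derivable ('D_v f) (x + s *: v + t *: w) w) ->
  exists s t, [/\ 0 <= s <= h, 0 <= t <= h &
    f (x + h *: v + h *: w) - f (x + h *: v) - (f (x + h *: w) - f x) =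
    h * (h * 'D_w ('D_v f) (x + s *: v + t *: w))].
Proof.
move=> h0 df.
have h00 : 0 <= (0 : R) <= h by rewrite lexx ltW.
have hhh : 0 <= h <= h by rewrite lexx ltW.
have dv s : 0 <= s <= h -> is_derive (x + s *: v) v (fun z => f (z + h *: w) - f z)
    ('D_v f (x + s *: v + h *: w) - 'D_v f (x + s *: v)).
  move=> sh; apply: is_deriveB.
    by apply: is_derive_translate; exact: (df s h sh hhh).1.
  by have [+ _] := df s 0 sh h00; rewrite scale0r addr0 => d0; exact: derivableP.
have [s sh E1] := MVT_line h0 (fun s sh => @ex_derive _ _ _ _ _ _ _ (dv s sh)).
have [t th E2] := @MVT_line R V ('D_v f) (x + s *: v) w h h0
  (fun t th => (df s t sh th).2).
exists s, t; split=> //.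
by rewrite -E2; have [_ <-] := dv s sh; rewrite -E1; ring.
Qed.

(** Equality of mixed derivatives.  On a small parallelogram at [x] the same
    second difference is [h ^+ 2] times a value of ['D_w ('D_v f)] and also
    [h ^+ 2] times a value of ['D_v ('D_w f)], both taken near [x]; by
    continuity the values at [x] cannot differ by a positive [d]. *)
Lemma derive_commute (R : realType) (V : normedModType R) (f : V -> R)
    (x v w : V) :
  (\forall y \near x, derivable f y v /\ derivable ('D_v f) y w) ->
  (\forall y \near x, derivable f y w /\ derivable ('D_w f) y v) ->
  {for x, continuous ('D_w ('D_v f))} ->
  {for x, continuous ('D_v ('D_w f))} ->
  'D_w ('D_v f) x = 'D_v ('D_w f) x.
Proof.
move=> dvw dwv cvw cwv.
apply/eqP; rewrite -subr_eq0 -normr_eq0.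
set d := `| _ |; apply: contraT => neq0.
have d2 : 0 < d / 2 by rewrite divr_gt0 // lt0r neq0 normr_ge0.
have nvw : \forall y \near x, `|'D_w ('D_v f) x - 'D_w ('D_v f) y| < d / 2.
  by move/cvgrPdist_lt : cvw; apply.
have nwv : \forall y \near x, `|'D_v ('D_w f) x - 'D_v ('D_w f) y| < d / 2.
  by move/cvgrPdist_lt : cwv; apply.
have [r /= r0 rP] :=
  (nbhs_normP _ _).1 (filterI (filterI dvw dwv) (filterI nvw nwv)).
(* [h] is small enough for the parallelogram of sides [h *: v] and [h *: w]
   to stay in the ball of radius [r]. *)
pose N := `|v| + `|w| + 1.
have N0 : 0 < N by rewrite ltr_wpDl // addr_ge0.
pose h := r / 2 / N.
have h0 : 0 < h by rewrite !divr_gt0.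
have box s t : 0 <= s <= h -> 0 <= t <= h ->
    ball_ Num.norm x r (x + s *: v + t *: w).
  move=> /andP[s0 sh] /andP[t0 th]; rewrite /ball_ /=.
  rewrite -addrA opprD addrA subrr sub0r normrN.
  rewrite (le_lt_trans (ler_normD _ _)) // !normrZ (ger0_norm s0) (ger0_norm t0).
  have hN : h * N = r / 2 by rewrite /h divfK // gt_eqF.
  have := ler_wpM2r (normr_ge0 v) sh; have := ler_wpM2r (normr_ge0 w) th.
  move: hN; rewrite /N !mulrDr mulr1; lra.
have [s [t [sh th E1]]] := @second_difference R V f x v w h h0
  (fun s t sh th => (rP _ (box s t sh th)).1.1).
have box' s' t' : 0 <= s' <= h -> 0 <= t' <= h ->
    ball_ Num.norm x r (x + s' *: w + t' *: v).
  by move=> *; rewrite addrAC; exact: box.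
have [s' [t' [sh' th' E2]]] := @second_difference R V f x w v h h0
  (fun s t sh th => (rP _ (box' s t sh th)).1.2).
have [_ [lt1 _]] := rP _ (box s t sh th).
have [_ [_ lt2]] := rP _ (box' s' t' sh' th').
have E : 'D_w ('D_v f) (x + s *: v + t *: w) = 'D_v ('D_w f) (x + s' *: w + t' *: v).
  have hn0 : h != 0 by rewrite gt_eqF.
  do 2 apply: (mulfI hn0).
  apply: etrans (esym E1) _; apply: etrans E2.
  (* Exchanging [v] and [w] only permutes the terms of the second difference. *)
  have swap (p q r' u : R) : p - q - (r' - u) = p - r' - (q - u) by ring.
  by rewrite swap [x + h *: v + h *: w]addrAC.
move: lt1 lt2; rewrite -E => lt1 lt2.
suff : d < d / 2 + d / 2 by rewrite -splitr ltxx.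
apply: le_lt_trans (ler_distD _ _ _) (ltrD lt1 _).
by rewrite distrC; exact: lt2.
Qed.

(** * Functions of class [C^k] on an open set *)

Section CnOn.
Context {R : realType} {n : nat}.
Implicit Types (W : set 'rV[R]_n) (f g : 'rV[R]_n -> R).

Lemma near_open_eq W f g x : open W -> (forall y, W y -> f y = g y) -> W x ->
  \forall y \near x, f y = g y.
Proof.
by move=> oW fg Wx; have := open_nbhs_nbhs (conj oW Wx); apply: filterS.
Qed.

Lemma partial_eq_on W f g i : open W -> (forall y, W y -> f y = g y) ->
  forall x, W x -> partial i f x = partial i g x.
Proof.
move=> oW fg x Wx; apply: near_eq_derive; exact: near_open_eq oW fg Wx.
Qed.

(** Derivatives at a point of the open set [W] only see the values on [W], so
    that the formulas below need only hold on [W], where denominators do not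
    vanish and matrices are invertible. *)
Lemma Cn_on_eq W k f g : open W -> (forall y, W y -> f y = g y) ->
  Cn_on k W f -> Cn_on k W g.
Proof.
move=> oW; elim: k f g => [|k IH] f g fg [cf df]; split=> //.
1,2: move=> x Wx; have nfg := near_open_eq oW fg Wx.
1,2: rewrite /prop_for /continuous_at -(fg x Wx).
1,2: exact: cvg_trans (near_eq_cvg nfg) (cf x Wx : f @ x --> f x).
move=> i; have [dfi cfi] := df i; split.
  move=> x Wx; apply: near_eq_derivable (dfi x Wx).
  exact: near_open_eq oW fg Wx.
exact: IH (partial_eq_on i oW fg) cfi.
Qed.

Lemma Cn_onS W k f : Cn_on k.+1 W f -> Cn_on k W f.
Proof.
elim: k f => [|k IH] f [cf df]; split=> // i.
by have [dfi cfi] := df i; split=> //; exact: IH.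
Qed.

Lemma Cn_on_cst W k (c : R) : Cn_on k W (fun=> c).
Proof.
elim: k c => [|k IH] c; first by split=> // x _; exact: cst_continuous.
split=> [x _|i]; first exact: cst_continuous.
split=> [x _|]; first exact: derivable_cst.
have -> : partial i (fun=> c) = (fun=> 0).
  by apply/funext => x; exact: derive_cst.
exact: IH.
Qed.

Lemma Cn_onD W k f g : open W -> Cn_on k W f -> Cn_on k W g ->
  Cn_on k W (fun x => f x + g x).
Proof.
move=> oW; elim: k f g => [|k IH] f g [cf df] [cg dg].
  by split=> // x Wx; exact: continuousD (cf x Wx) (cg x Wx).
split=> [x Wx|i]; first exact: continuousD (cf x Wx) (cg x Wx).
have [dfi cfi] := df i; have [dgi cgi] := dg i.
split=> [x Wx|]; first exact: derivableD (dfi x Wx) (dgi x Wx).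
apply: Cn_on_eq oW _ (IH _ _ cfi cgi) => x Wx.
by apply/esym; exact: deriveD (dfi x Wx) (dgi x Wx).
Qed.

Lemma Cn_onM W k f g : open W -> Cn_on k W f -> Cn_on k W g ->
  Cn_on k W (fun x => f x * g x).
Proof.
move=> oW; elim: k f g => [|k IH] f g Cf Cg; have [cf df] := Cf; have [cg dg] := Cg.
  by split=> // x Wx; exact: continuousM (cf x Wx) (cg x Wx).
split=> [x Wx|i]; first exact: continuousM (cf x Wx) (cg x Wx).
have [dfi cfi] := df i; have [dgi cgi] := dg i.
split=> [x Wx|]; first exact: derivableM (dfi x Wx) (dgi x Wx).
apply: (Cn_on_eq oW (f := fun x => f x * partial i g x + g x * partial i f x)).
  by move=> x Wx; apply/esym; exact: deriveM (dfi x Wx) (dgi x Wx).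
by apply: Cn_onD => //; apply: IH => //; exact: Cn_onS.
Qed.

Lemma Cn_onV W k f : open W -> (forall x, W x -> f x != 0) ->
  Cn_on k W f -> Cn_on k W (fun x => (f x)^-1).
Proof.
move=> oW f0; elim: k => [|k IH] Cf; have [cf df] := Cf.
  by split=> // x Wx; exact: continuousV (f0 x Wx) (cf x Wx).
split=> [x Wx|i]; first exact: continuousV (f0 x Wx) (cf x Wx).
have [dfi cfi] := df i.
split=> [x Wx|]; first exact: derivableV (f0 x Wx) (dfi x Wx).
have CV := IH (Cn_onS Cf).
apply: (Cn_on_eq oW (f := fun x => -1 * ((f x)^-1 * (f x)^-1) * partial i f x)).
  move=> x Wx; have /esym := deriveV (f0 x Wx) (dfi x Wx).
  by rewrite mulN1r -expr2 exprVn.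
apply: Cn_onM => //; apply: Cn_onM => //; first exact: Cn_on_cst.
exact: Cn_onM.
Qed.

Lemma Cn_on_sum W k (I : Type) (r : seq I) (F : I -> 'rV[R]_n -> R) : open W ->
  (forall i, Cn_on k W (F i)) -> Cn_on k W (fun x => \sum_(i <- r) F i x).
Proof.
move=> oW CF; elim: r => [|i r IH].
  by apply: Cn_on_eq (Cn_on_cst W k 0) => // x _; rewrite big_nil.
by apply: Cn_on_eq (Cn_onD oW (CF i) IH) => // x _; rewrite big_cons.
Qed.

Lemma Cn_on_prod W k (I : Type) (r : seq I) (F : I -> 'rV[R]_n -> R) : open W ->
  (forall i, Cn_on k W (F i)) -> Cn_on k W (fun x => \prod_(i <- r) F i x).
Proof.
move=> oW CF; elim: r => [|i r IH].
  by apply: Cn_on_eq (Cn_on_cst W k 1) => // x _; rewrite big_nil.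
by apply: Cn_on_eq (Cn_onM oW (CF i) IH) => // x _; rewrite big_cons.
Qed.

Lemma Cn_on_det W k m (M : 'rV[R]_n -> 'M[R]_m) : open W ->
  (forall i j, Cn_on k W (fun x => M x i j)) -> Cn_on k W (fun x => \det (M x)).
Proof.
move=> oW CM; apply: Cn_on_sum => // s; apply: Cn_onM => //.
  exact: Cn_on_cst.
by apply: Cn_on_prod => // i; exact: CM.
Qed.

(** Cramer's formula makes the entries of the inverse rational in those of
    [M], with a denominator that does not vanish on [W]. *)
Lemma Cn_on_invmx W k m (M : 'rV[R]_n -> 'M[R]_m) : open W ->
  (forall x, W x -> M x \in unitmx) ->
  (forall i j, Cn_on k W (fun x => M x i j)) ->
  forall i j, Cn_on k W (fun x => invmx (M x) i j).
Proof.
move=> oW uM CM i j.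
apply: (Cn_on_eq oW (f := fun x => (\det (M x))^-1 * ((-1) ^+ (j + i) *
    \det (row' j (col' i (M x)))))).
  by move=> x Wx; rewrite /invmx uM // !mxE.
apply: Cn_onM => //.
  apply: Cn_onV => //; last exact: Cn_on_det.
  by move=> x /uM; rewrite unitmxE unitfE.
apply: Cn_onM => //; first exact: Cn_on_cst.
apply: Cn_on_det => // a b.
by apply: Cn_on_eq (CM (lift j a) (lift i b)) => // x _; rewrite !mxE.
Qed.

Lemma partial_partial_cont W k i j f : Cn_on k.+2 W f ->
  forall x, W x -> {for x, continuous (partial i (partial j f))}.
Proof. by move=> [_ /(_ j)[_ [_ /(_ i)[_]]]]; case: k => [|k] []. Qed.

Lemma partialC W f i j : open W -> Cn_on 2 W f ->
  forall x, W x -> partial i (partial j f) x = partial j (partial i f) x.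
Proof.
move=> oW Cf x Wx; have nW := open_nbhs_nbhs (conj oW Wx).
have d a b y : W y -> derivable f y (delta_mx 0 a) /\
    derivable (partial a f) y (delta_mx 0 b).
  move=> Wy; have [_ /(_ a)[da [_ /(_ b)[db _]]]] := Cf.
  by split; [exact: da|exact: db].
apply: derive_commute.
- by apply: filterS nW => y; exact: d.
- by apply: filterS nW => y; exact: d.
- exact: partial_partial_cont Cf _ Wx.
- exact: partial_partial_cont Cf _ Wx.
Qed.

(** Four transpositions of adjacent derivatives turn [iijj] into [jjii]; each
    is applied to a function that is still twice differentiable. *)
Lemma partial2C W f i j : open W -> Cn_on 4 W f -> forall x, W x ->
  partial i (partial i (partial j (partial j f))) x =
  partial j (partial j (partial i (partial i f))) x.
Proof.
move=> oW Cf.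
have C3 a : Cn_on 3 W (partial a f) by have [_ /(_ a)[]] := Cf.
have C2 a b : Cn_on 2 W (partial a (partial b f)) by have [_ /(_ a)[]] := C3 b.
have C2f := Cn_onS (Cn_onS Cf).
have swap a b : forall x, W x ->
    partial a (partial b (partial b f)) x = partial b (partial b (partial a f)) x.
  move=> x Wx; rewrite (partialC _ _ oW (Cn_onS (C3 b)) Wx).
  by apply: (partial_eq_on _ oW _ Wx) => y Wy; exact: partialC oW C2f _ Wy.
move=> x Wx; rewrite (partial_eq_on i oW (swap i j) Wx).
rewrite (partialC _ _ oW (C2 _ _) Wx); apply: (partial_eq_on _ oW _ Wx) => y Wy.
rewrite (partialC _ _ oW (Cn_onS (C3 i)) Wy).
exact: erefl.
Qed.
End CnOn.

(** * Separation of variables *)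

Section StackelOperators.
Context {R : realType} {n : nat}.
Implicit Types (W : set 'rV[R]_n) (u f : 'rV[R]_n -> R).

(** The condition also compares points of [W] that no segment inside [W] joins:
    a vanishing [partial j] would not give this, and [row_separated] does. *)
Definition independent_of W (j : 'I_n) u :=
  forall y z, W y -> W z -> (forall k, k != j -> y 0 k = z 0 k) -> u y = u z.

Lemma is_derive_independent W j u x : open W -> independent_of W j u -> W x ->
  is_derive x (delta_mx 0 j) u 0.
Proof.
move=> oW uj Wx; set e := delta_mx 0 j.
have line : x + t *: e @[t --> (0 : R)] --> x.
  rewrite -[X in _ --> X]addr0 -(scale0r e).
  by apply: cvgD; [exact: cvg_cst|apply: cvgZr_tmp; exact: cvg_id].
have Wline : \forall t \near (0 : R), W (x + t *: e).
  by apply: line; exact: open_nbhs_nbhs (conj oW Wx).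
have quot0 : h^-1 *: ((u \o shift x) (h *: e) - u x) @[h --> (0 : R)^'] --> (0 : R).
  apply: cvg_near_cst; apply: nbhs_dnbhs; apply: filterS Wline => t Wt /=.
  rewrite [t *: e + x]addrC (uj _ x Wt Wx) ?subrr ?scaler0 // => k kj.
  by rewrite !mxE eqxx (negbTE kj) mulr0 addr0.
split; first by apply/cvg_ex; exists 0.
exact: cvg_lim quot0.
Qed.

Lemma partial_independentM W j u f x : open W -> independent_of W j u -> W x ->
  derivable f x (delta_mx 0 j) ->
  partial j (fun y => u y * f y) x = u x * partial j f x.
Proof.
move=> oW uj Wx df; have [du Du] := is_derive_independent oW uj Wx.
have := deriveM du df; rewrite Du scaler0 addr0; exact.
Qed.

Lemma row_separated_independent W (S : 'rV[R]_n -> 'M[R]_n) i j b :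
  row_separated W S -> j != i -> independent_of W j (fun y => S y i b).
Proof.
by move=> Srow ji y z Wy Wz yz; apply: Srow => //; apply: yz; rewrite eq_sym.
Qed.

(** The entry [(a, i)] of the adjugate is a cofactor along the [i]-th row of
    [S]: this row, the only one that varies with [x_i], is deleted. *)
Lemma adjugate_independent W (S : 'rV[R]_n -> 'M[R]_n) a i :
  row_separated W S -> independent_of W i (fun y => (\adj (S y)) a i).
Proof.
move=> Srow y z Wy Wz yz; rewrite !mxE; congr (_ * \det _).
apply/matrixP => k l; rewrite !mxE; apply: Srow => //.
by apply: yz; rewrite eq_sym neq_lift.
Qed.

Lemma adjugate_invmx m (A : 'M[R]_m) : A \in unitmx ->
  \adj A = \det A *: invmx A.
Proof.
move=> uA; rewrite /invmx uA scalerA divff ?scale1r //.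
by move: uA; rewrite unitmxE unitfE.
Qed.

(** Polarisation: the quadratic form [H a x] is [\sum_i (S^-1)_ai p_i^2], and
    its values at the basis vectors and at their pairwise sums determine a
    symmetric matrix. *)
Lemma stackel_tensor W (S : 'rV[R]_n -> 'M[R]_n)
    (H : 'I_n -> 'rV[R]_n -> 'rV[R]_n -> R) (K : 'rV[R]_n -> 'M[R]_n) a x :
  stackel_hamiltonians W S H -> symmetric_tensor_of W (H a) K ->
  W x -> S x \in unitmx ->
  K x = diag_mx (row a (invmx (S x))).
Proof.
move=> HS KH Wx uS; have [Ksym KE] := KH x Wx.
have HE p : H a x p = \sum_i invmx (S x) a i * p 0 i ^+ 2.
  have /(congr1 (fun M => (invmx (S x) *m M) a 0)) := HS x p Wx.
  by rewrite mulKmx // !mxE => ->; apply: eq_bigr => i _; rewrite mxE.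
have Kdiag i : K x i i = invmx (S x) a i.
  have := KE (delta_mx 0 i); rewrite HE (bigD1 i) //= big1 => [|k ki]; last first.
    by rewrite mxE eqxx (negbTE ki) expr0n mulr0.
  rewrite (bigD1 i) //= [X in _ = _ + X]big1 => [|k ki]; last first.
    by rewrite big1 // => l _; rewrite !mxE eqxx (negbTE ki) mulr0 mul0r.
  rewrite (bigD1 i) //= [X in _ = _ + X + _]big1 => [|k ki]; last first.
    by rewrite !mxE eqxx (negbTE ki) mulr0.
  by rewrite !mxE !eqxx expr1n !mulr1 !addr0 => ->.
apply/matrixP => i j; rewrite !mxE; case: eqVneq => [<-|ij]; first by rewrite Kdiag.
rewrite mulr0n.
have := KE (delta_mx 0 i + delta_mx 0 j).
have ji : j != i by rewrite eq_sym.
rewrite HE (bigD1 i) //= (bigD1 j) //= big1 => [|k /andP[ki kj]]; last first.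
  by rewrite !mxE eqxx (negbTE ki) (negbTE kj) addr0 expr0n mulr0.
have inner k : \sum_l K x k l * (delta_mx 0 i + delta_mx 0 j : 'rV[R]_n) 0 k *
    (delta_mx 0 i + delta_mx 0 j : 'rV[R]_n) 0 l =
    ((k == i)%:R + (k == j)%:R) * (K x k i + K x k j).
  rewrite (bigD1 i) //= (bigD1 j) //= big1 => [|l /andP[li lj]]; last first.
    by rewrite !mxE eqxx (negbTE li) (negbTE lj) addr0 mulr0.
  by rewrite !mxE !eqxx (negbTE ij) (negbTE ji) /=; ring.
under [in RHS]eq_bigr do rewrite inner.
rewrite (bigD1 i) //= [in RHS](bigD1 j) //=.
rewrite [X in _ = _ + (_ + X)]big1 => [|k /andP[ki kj]]; last first.
  by rewrite (negbTE ki) (negbTE kj) addr0 mul0r.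
rewrite !mxE !eqxx (negbTE ij) (negbTE ji) -!Kdiag.
have -> : K x j i = K x i j by rewrite -[in LHS]Ksym mxE.
move=> /= E; lra.
Qed.

(** * The operators with leading coefficients in the inverse matrix *)

Definition stackel_op (S : 'rV[R]_n -> 'M[R]_n) (a : 'I_n) f x : R :=
  \sum_i invmx (S x) a i * partial i (partial i f) x.

Lemma stackel_op_eq_on W (S : 'rV[R]_n -> 'M[R]_n) a f g x : open W ->
  (forall y, W y -> f y = g y) -> W x -> stackel_op S a f x = stackel_op S a g x.
Proof.
move=> oW fg Wx; apply: eq_bigr => i _; apply: congr1.
apply: (partial_eq_on _ oW _ Wx) => y Wy; exact: partial_eq_on oW fg _ Wy.
Qed.

(** No first-order term appears: the coefficient under [partial i] is an
    adjugate entry, which does not depend on [x_i]. *)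
Lemma divergence_op_stackel W (S : 'rV[R]_n -> 'M[R]_n)
    (H : 'I_n -> 'rV[R]_n -> 'rV[R]_n -> R) (K : 'rV[R]_n -> 'M[R]_n) a f x :
  open W -> (forall x, W x -> S x \in unitmx) -> row_separated W S ->
  stackel_hamiltonians W S H -> symmetric_tensor_of W (H a) K ->
  Cn_on 2 W f -> W x ->
  divergence_op (fun y => \det (S y)) K f x = stackel_op S a f x.
Proof.
move=> oW uS Srow HS KH Cf Wx; apply: eq_bigr => i _.
have KE y (Wy : W y) := stackel_tensor HS KH Wy (uS y Wy).
rewrite (bigD1 i) //= big1 => [|j ji]; last first.
  rewrite (partial_eq_on (g := fun=> 0) _ oW _ Wx) => [|y Wy].
    by rewrite [partial _ _ _]derive_cst mulr0.
  by rewrite KE // !mxE eq_sym (negbTE ji) mulr0n !mul0r.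
rewrite addr0.
rewrite (partial_eq_on (g := fun y => (\adj (S y)) a i * partial i f y) _ oW _ Wx);
  last first.
  move=> y Wy; rewrite KE // adjugate_invmx ?uS // [in RHS]mxE !mxE eqxx mulr1n.
  by rewrite [_ * \det _]mulrC.
rewrite (partial_independentM oW (adjugate_independent a Srow) Wx); last first.
  by have [_ /(_ i)[_ [_ /(_ i)[df _]]]] := Cf; exact: df.
rewrite mulrA; congr (_ * _).
by rewrite adjugate_invmx ?uS // mxE mulKf // -unitfE -unitmxE uS.
Qed.

Lemma stackel_opE (S : 'rV[R]_n -> 'M[R]_n) i f x : S x \in unitmx ->
  \sum_b S x i b * stackel_op S b f x = partial i (partial i f) x.
Proof.
move=> uS; pose q : 'cV[R]_n := \col_j partial j (partial j f) x.
have /(congr1 (fun M : 'cV_n => M i 0)) := mulKVmx uS q.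
rewrite !mxE => <-; apply: eq_bigr => b _; rewrite !mxE; congr (_ * _).
by apply: eq_bigr => j _; rewrite mxE.
Qed.

Lemma Cn_on_stackel_op W (S : 'rV[R]_n -> 'M[R]_n) a f k : open W ->
  (forall x, W x -> S x \in unitmx) ->
  (forall i j, Cn_on k W (fun x => S x i j)) ->
  Cn_on k.+2 W f -> Cn_on k W (stackel_op S a f).
Proof.
move=> oW uS CS Cf; apply: Cn_on_sum => // i; apply: Cn_onM => //.
  exact: Cn_on_invmx.
by have [_ /(_ i)[_ [_ /(_ i)[_]]]] := Cf.
Qed.

Lemma partial_row_sum W (S : 'rV[R]_n -> 'M[R]_n) (g : 'I_n -> 'rV[R]_n -> R)
    i j x : open W -> row_separated W S -> j != i ->
  (forall i j, Cn_on 1 W (fun x => S x i j)) ->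
  (forall b, Cn_on 1 W (g b)) -> W x ->
  partial j (fun y => \sum_b S y i b * g b y) x =
  \sum_b S x i b * partial j (g b) x.
Proof.
move=> oW Srow ji CS Cg Wx.
have dg b : derivable (g b) x (delta_mx 0 j).
  by have [_ /(_ j)[dg _]] := Cg b; exact: dg.
have d b : derivable (fun y => S y i b * g b y) x (delta_mx 0 j).
  by have [_ /(_ j)[dSg _]] := Cn_onM oW (CS i b) (Cg b); exact: dSg.
have := derive_sum d; rewrite fct_sumE => E; apply: etrans E _.
apply: eq_bigr => b _.
exact: partial_independentM oW (row_separated_independent b Srow ji) Wx (dg b).
Qed.

(** The [i]-th row of [S] behaves as a constant for [partial j]. *)
Lemma partial2_row_sum W (S : 'rV[R]_n -> 'M[R]_n) (g : 'I_n -> 'rV[R]_n -> R)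
    i j x : open W -> row_separated W S -> j != i ->
  (forall i j, Cn_on 1 W (fun x => S x i j)) ->
  (forall b, Cn_on 2 W (g b)) -> W x ->
  partial j (partial j (fun y => \sum_b S y i b * g b y)) x =
  \sum_b S x i b * partial j (partial j (g b)) x.
Proof.
move=> oW Srow ji CS Cg Wx.
rewrite (partial_eq_on _ oW (fun y Wy =>
  partial_row_sum oW Srow ji CS (fun b => Cn_onS (Cg b)) Wy) Wx).
by apply: partial_row_sum oW Srow ji CS _ Wx => b; have [_ /(_ j)[]] := Cg b.
Qed.

Lemma congr_mx_sym m (A M : 'M[R]_m) : A \in unitmx ->
  (A *m M *m A^T)^T = A *m M *m A^T -> M^T = M.
Proof.
move=> uA; rewrite !trmx_mul trmxK mulmxA.
move=> /(can_inj (mulmxK _)); rewrite unitmx_tr => /(_ uA).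
exact: (can_inj (mulKmx uA)).
Qed.

(** The matrix [M] of iterated operators is symmetric because its congruent
    [S *m M *m S^T] has the entries [(partial j)^2 (partial i)^2 f] off the
    diagonal. *)
Lemma stackel_opC W (S : 'rV[R]_n -> 'M[R]_n) a b f x : open W ->
  (forall x, W x -> S x \in unitmx) -> row_separated W S ->
  (forall i j, Cn_on 2 W (fun x => S x i j)) -> Cn_on 4 W f -> W x ->
  stackel_op S a (stackel_op S b f) x = stackel_op S b (stackel_op S a f) x.
Proof.
move=> oW uS Srow CS Cf Wx.
pose M : 'M[R]_n := \matrix_(c, d) stackel_op S c (stackel_op S d f) x.
pose N := S x *m M *m (S x)^T.
have NE i j : j != i ->
    N j i = partial j (partial j (partial i (partial i f))) x.
  move=> ji.
  have Cg c : Cn_on 2 W (stackel_op S c f) by exact: Cn_on_stackel_op.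
  have CS1 c d := Cn_onS (CS c d).
  transitivity (\sum_d S x i d * partial j (partial j (stackel_op S d f)) x).
    rewrite mxE; apply: eq_bigr => d _; rewrite mulrC !mxE; congr (_ * _).
    by rewrite -(stackel_opE _ _ (uS x Wx)); apply: eq_bigr => c _; rewrite mxE.
  rewrite -(partial2_row_sum oW Srow ji CS1 Cg Wx).
  have Ei y (Wy : W y) := stackel_opE i f (uS y Wy).
  apply: (partial_eq_on _ oW _ Wx) => y Wy.
  exact: partial_eq_on oW Ei _ Wy.
have Nsym : N^T = N.
  apply/matrixP => i j; rewrite mxE; case: (eqVneq j i) => [->//|ji].
  have ij : i != j by rewrite eq_sym.
  by rewrite (NE i j ji) (NE j i ij); exact: (partial2C _ _ oW Cf Wx).
have /matrixP/(_ b a) := congr_mx_sym (uS x Wx) Nsym.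
by rewrite !mxE.
Qed.
End StackelOperators.

Theorem theorem2 (R : realType) (n : nat) (W : set 'rV[R]_n)
    (S : 'rV[R]_n -> 'M[R]_n)
    (H : 'I_n -> 'rV[R]_n -> 'rV[R]_n -> R)
    (K : 'I_n -> 'rV[R]_n -> 'M[R]_n)
    (W_open : open W)
    (W_sc : simply_connected R W)
    (S_smooth : forall i j, smooth_on W (fun x => S x i j))
    (S_nondeg : forall x, W x -> S x \in unitmx)
    (S_rows : row_separated W S)
    (H_stackel : stackel_hamiltonians W S H)
    (K_tensor : forall a, symmetric_tensor_of W (H a) (K a)) :
  let phi := fun x => \det (S x) in
  let Hhat := fun a => divergence_op phi (K a) in
  forall (a b : 'I_n) (f : 'rV[R]_n -> R), smooth_on W f ->
    forall x, W x -> Hhat a (Hhat b f) x = Hhat b (Hhat a f) x.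
Proof.
move=> phi Hhat a b f Cf x Wx.
have S2 i j : Cn_on 2 W (fun x => S x i j) := S_smooth i j 2%N.
have HhatE c h : Cn_on 2 W h -> forall y, W y -> Hhat c h y = stackel_op S c h y.
  by move=> Ch y; exact: divergence_op_stackel (K_tensor c) Ch.
have C2 c h : Cn_on 4 W h -> Cn_on 2 W (Hhat c h).
  move=> Ch; have Ch2 := Cn_onS (Cn_onS Ch).
  apply: (Cn_on_eq W_open (fun y Wy => esym (HhatE c h Ch2 y Wy))).
  exact: Cn_on_stackel_op W_open S_nondeg S2 Ch.
have HH c d : Hhat c (Hhat d f) x = stackel_op S c (stackel_op S d f) x.
  rewrite (HhatE c _ (C2 d f (Cf 4%N)) x Wx).
  exact: stackel_op_eq_on W_open (HhatE d f (Cf 2%N)) Wx.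
rewrite !HH; exact: stackel_opC W_open S_nondeg S_rows S2 (Cf 4%N) Wx.
Qed.
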